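(* Let $\Sigma,\Delta$ be finite alphabets with $k=|\Sigma|\leq|\Delta|=m$. Let $\alpha_n$ and $\beta_n$ be the numbers of morphisms and of marked morphisms, respectively, from $\Sigma^*$ to $\Delta^*$ such that the images of all letters of $\Sigma$ have length at most $n$. Then the density of the marked morphisms among all morphisms is a positive constant: $$\lim_{n\to\infty}\frac{\beta_n}{\alpha_n}=\frac{m!}{m^k(m-k)!}.$$
   Context: $\Sigma^*$ is the free monoid on $\Sigma$. A monoid morphism $f:\Sigma^*\to\Delta^*$ is marked if $f(a)$ is a non-empty word for every $a\in\Sigma$ and, for distinct $a,b\in\Sigma$, the words $f(a)$ and $f(b)$ start with different letters of $\Delta$. *)

(* Defs.v *)
From HB Require Import structures.
From mathcomp Require Import all_boot all_order all_algebra finmap.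
From mathcomp Require Import all_classical all_reals all_analysis.
Set Implicit Arguments.
Unset Strict Implicit.
Unset Printing Implicit Defensive.
Import numFieldNormedType.Exports.
Local Open Scope classical_set_scope.

(* The free monoid on T is [seq T]; the empty word is its unit. *)
HB.instance Definition _ (T : choiceType) :=
  isMonoid.Build (seq T) (@catA T) (@cat0s T) (@cats0 T).

Section Morphisms.
Variables Sigma Delta : finType.
Implicit Types (f : seq Sigma -> seq Delta) (n : nat).

(* Given the first condition, the heads compared in the second are letters,
   never [None]. *)
Definition marked f : Prop :=
  (forall a, f [:: a] <> [::]) /\
  (forall a b, a <> b -> ohead (f [:: a]) <> ohead (f [:: b])).

Definition bounded_morphisms n : set (seq Sigma -> seq Delta) :=
  [set f | monoid.monoid_morphism f /\
           forall a, (size (f [:: a]) <= n)%N].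

Definition bounded_marked_morphisms n : set (seq Sigma -> seq Delta) :=
  [set f | bounded_morphisms n f /\ marked f].

(* [fset_set] returns [fset0] on infinite sets; this lemma ensures that the
   cardinals below are the genuine ones. *)
Lemma finite_bounded_morphisms n : finite_set (bounded_morphisms n).
Proof.
pose code f : {ffun Sigma -> n.-bseq Delta} :=
  [ffun a => insub_bseq n (f [:: a])].
have code_inj : {in bounded_morphisms n &, injective code}.
  move=> f g /set_mem[[f1 fM] fn] /set_mem[[g1 gM] gn] fg.
  have fcat u v : f (u ++ v) = f u ++ f v by exact: fM.
  have gcat u v : g (u ++ v) = g u ++ g v by exact: gM.
  apply/funext; elim=> [|a w IH]; first exact: etrans f1 (esym g1).
  rewrite -cat1s fcat gcat IH; congr (_ ++ _).
  have /(congr1 val) : code f a = code g a by rewrite fg.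
  by rewrite !ffunE /insub_bseq !insubdK //; [exact: gn | exact: fn].
apply: (@card_le_finite _ _ _ [set: {ffun Sigma -> n.-bseq Delta}]).
  rewrite -(card_le_eql (inj_card_eq code_inj)).
  exact: (card_le_trans (subset_card_le (@subsetT _ _))).
exact: finite_finset.
Qed.

Definition alpha n : nat := #|` fset_set (bounded_morphisms n)|.

Definition beta n : nat := #|` fset_set (bounded_marked_morphisms n)|.

End Morphisms.

(* Main.v *)
Require Import Defs.
From mathcomp Require Import all_boot all_order all_algebra finmap.
From mathcomp Require Import all_classical all_reals all_analysis.
Import numFieldNormedType.Exports GRing.Theory Num.Theory Order.TTheory.
Local Open Scope classical_set_scope.
Local Open Scope ring_scope.

(** A morphism on a free monoid is freely determined by the images of the
    letters. Write W n for the number of words of length at most n over Delta.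
    Choosing one such word for each letter of Sigma gives alpha n = W n ^ k
    ([alphaE]).  A marked morphism whose images have length at most n + 1 is an
    injection Sigma -> Delta, giving the first letters, together with an
    arbitrary word of length at most n for each letter of Sigma, giving what
    follows the first letter. Hence beta (n + 1) = m ^_ k * W n ^ k ([betaE]),
    with m ^_ k = m! / (m - k)! the falling factorial.

    Therefore beta (n + 1) / alpha (n + 1) = m ^_ k * (W n / W (n + 1)) ^ k.
    Splitting off the first letter of a nonempty word gives
    W (n + 1) = 1 + m * W n, and W n tends to infinity when m > 0, so
    W n / W (n + 1) tends to 1 / m ([cvg_card_bseq_ratio]), and the limit is
    m ^_ k / m ^ k. When m = 0, also k = 0, and both the ratios and the limit
    are equal to 1. *)

(** Reduces counting either family of morphisms, a set in an infinite function
    type, to finding an injective parametrisation by a finite type. *)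
Lemma card_fset_set_range (I : finType) (T : choiceType) (g : I -> T) :
  injective g -> #|` fset_set (range g)| = #|I|.
Proof.
move=> g_inj; have -> : range g = [set` [fset g x | x in I]%fset].
  apply/seteqP; split=> [_ [x _ <-]|_ /imfsetP[x _ ->]]; last by exists x.
  exact/in_imfset.
by rewrite set_fsetK card_imfset // cardE.
Qed.

Definition extension {S D : finType} (phi : S -> seq D) (w : seq S) : seq D :=
  flatten (map phi w).

Lemma extension1 (S D : finType) (phi : S -> seq D) a :
  extension phi [:: a] = phi a.
Proof. exact: cats0. Qed.

Lemma extension_inj (S D : finType) (phi psi : S -> seq D) :
  extension phi = extension psi -> phi =1 psi.
Proof. by move=> e a; rewrite -extension1 e extension1. Qed.

Lemma extension_morphism (S D : finType) (phi : S -> seq D) :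
  monoid.monoid_morphism (extension phi).
Proof.
split=> // u v; change (extension phi (u ++ v) = extension phi u ++ extension phi v).
by rewrite /extension map_cat flatten_cat.
Qed.

Lemma morphism_extension (S D : finType) (f : seq S -> seq D) (phi : S -> seq D) :
  monoid.monoid_morphism f -> (forall a, phi a = f [:: a]) -> extension phi = f.
Proof.
move=> [f1 fM] phiE; apply/funext; elim=> [|a w IH]; first exact: esym f1.
have -> : f (a :: w) = f [:: a] ++ f w by exact: (fM [:: a]).
by rewrite -IH -phiE.
Qed.

(** The parameter of a morphism is its restriction to the letters. *)
Lemma alphaE (S D : finType) n : alpha S D n = (#|{: n.-bseq D}| ^ #|S|)%N.
Proof.
pose ext (g : {ffun S -> n.-bseq D}) := extension (fun a => g a).
have ext_inj : injective ext.
  by move=> g h /extension_inj gh; apply/ffunP => a; apply/val_inj/gh.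
rewrite -card_ffun -(card_fset_set_range _ _ _ ext_inj) /alpha; congr #|` fset_set _|.
apply/seteqP; split=> [f [fM fn]|_ [g _ <-]].
  exists [ffun a => Bseq (fn a)] => //.
  by apply: morphism_extension => // a; rewrite ffunE.
split=> [|a]; first exact: extension_morphism.
by rewrite /ext extension1 size_bseq.
Qed.

(** Cutting off the first letter shortens the word by one, hence the shift of
    the index. The count is stated at n + 1 because at n = 0 no image can be
    non-empty. *)
Lemma betaE (S D : finType) n :
  beta S D n.+1 = (#|D| ^_ #|S| * #|{: n.-bseq D}| ^ #|S|)%N.
Proof.
pose word (p : {h : {ffun S -> D} | injectiveb h} * {ffun S -> n.-bseq D}) a :=
  val p.1 a :: p.2 a.
pose ext p := extension (word p).
have ext_inj : injective ext.
  move=> [h t] [h' t'] /extension_inj e; congr pair.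
    by apply/val_inj/ffunP => a; have [] := e a.
  by apply/ffunP => a; apply/val_inj; have [] := e a.
rewrite -card_ffun -card_inj_ffuns cardsE -[X in (X * _)%N]card_sig -card_prod.
rewrite -(card_fset_set_range _ _ _ ext_inj) /beta; congr #|` fset_set _|.
apply/seteqP; split=> [f [[fM fn] [f_ne f_head]]|_ [[h t] _ <-]].
  (* The boundedness of f leaves n places after the first letter. *)
  have word_split a : exists xy : D * n.-bseq D, f [:: a] = xy.1 :: xy.2.
    case fa: (f [:: a]) (f_ne a) (fn a) => [//|x y] _ yn.
    by exists (x, Bseq (yn : (size y <= n)%N)).
  have [u uE] := choice word_split.
  have u_inj : injectiveb [ffun a => (u a).1].
    apply/injectiveP => a b; rewrite !ffunE => uab; apply: contrapT => /f_head.
    by rewrite !uE /= uab.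
  exists (Sub [ffun a => (u a).1] u_inj, [ffun a => (u a).2]) => //.
  by apply: morphism_extension => // a; rewrite uE /word /= !ffunE.
split; [split=> [|a]|split=> [a|a b ab]]; rewrite /ext ?extension1 //=.
- exact: extension_morphism.
- exact: size_bseq.
- by move=> [hab]; apply: ab; apply/(injectiveP _ (valP h)).
Qed.

Lemma card_bseqS (D : finType) n :
  #|{: n.+1.-bseq D}| = (1 + #|D| * #|{: n.-bseq D}|)%N.
Proof.
rewrite !card_bseq big_ord_recl expn0 big_distrr; congr (_ + _)%N.
by apply: eq_bigr => i _; rewrite /= -expnS.
Qed.

(** This crude linear bound, attained over a one-letter alphabet, already makes
    the inverses of the numbers of words tend to 0. *)
Lemma leq_card_bseq (D : finType) n : (0 < #|D|)%N -> (n < #|{: n.-bseq D}|)%N.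
Proof.
move=> D_gt0; elim: n => [|n IH]; first by rewrite card_bseq big_ord1.
by rewrite card_bseqS ltnS (leq_trans IH) // leq_pmull.
Qed.

(** By the recurrence, |D| times the ratio is 1 minus the inverse of the number
    of words of length at most n + 1. *)
Lemma cvg_card_bseq_ratio (R : realType) (D : finType) : (0 < #|D|)%N ->
  (#|{: n.-bseq D}|%:R / #|{: n.+1.-bseq D}|%:R : R) @[n --> \oo]
    --> (#|D|%:R^-1 : R).
Proof.
move=> D_gt0; pose w n : R := #|{: n.-bseq D}|%:R.
have w_gt0 n : 0 < w n by rewrite ltr0n (leq_trans _ (leq_card_bseq _ _ D_gt0)).
have D_neq0 : (#|D|%:R : R) != 0 by rewrite pnatr_eq0 -lt0n.
have wS n : w n.+1 = 1 + #|D|%:R * w n by rewrite /w card_bseqS natrD natrM.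
have w_inv : (w n)^-1 @[n --> \oo] --> (0 : R).
  apply: (squeeze_cvgr _ (cvg_cst 0) cvg_harmonic).
  near=> n; rewrite invr_ge0 (ltW (w_gt0 n)) /= lef_pV2 ?posrE ?w_gt0 ?ltr0n //.
  by rewrite ler_nat leq_card_bseq.
have -> : (fun n => w n / w n.+1) = (fun n => #|D|%:R^-1 * (1 - (w n.+1)^-1)).
  apply/funext => n; apply: (mulfI D_neq0).
  rewrite mulVKf // mulrA -[in LHS](addKr 1 (_ * w n)) -wS addrC.
  by rewrite mulrBl divff ?lt0r_neq0 // mul1r.
rewrite -[X in _ --> X]mulr1 -[X in _ * X]subr0.
apply: cvgMl_tmp; apply: cvgB; first exact: cvg_cst.
by rewrite (cvg_shiftS (fun n => (w n)^-1)).
Unshelve. all: by end_near. Qed.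

Theorem proposition10p1 (R : realType) (Sigma Delta : finType) (k m : nat)
    (hk : #|Sigma| = k) (hm : #|Delta| = m) (hkm : (k <= m)%N) :
  let c : R := (m`!)%:R / ((m ^ k * (m - k)`!)%N)%:R in
  ((beta Sigma Delta n)%:R / (alpha Sigma Delta n)%:R : R) @[n --> \oo] --> c
  /\ 0 < c.
Proof.
move=> c; have mk_gt0 : (0 < m ^ k)%N.
  by rewrite expn_gt0; case: (k) hkm => [|i /(leq_trans _) ->]; rewrite ?orbT.
split; last by rewrite divr_gt0 // ltr0n ?muln_gt0 ?mk_gt0 fact_gt0.
have -> : c = (m ^_ k)%:R * m%:R^-1 ^+ k.
  by rewrite /c -(ffact_fact hkm) !natrM natrX exprVn -mulf_div divff ?mulr1 //.
pose r n : R := (beta Sigma Delta n)%:R / (alpha Sigma Delta n)%:R.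
(* Dropping the index 0 leaves the limit unchanged and makes [betaE] apply. *)
rewrite -(cvg_shiftS r) /r /=.
under eq_fun do rewrite betaE alphaE hk hm natrM !natrX -mulrA -expr_div_n.
(* For k = 0 the alphabet Delta may be empty, and the base of the power then
   does not tend to m^-1. *)
apply: cvgMl_tmp; have [->|k_neq0] := eqVneq k 0%N.
  by under eq_fun do rewrite expr0; exact: cvg_cst.
have D_gt0 : (0 < #|Delta|)%N by rewrite hm (leq_trans _ hkm) // lt0n.
apply: (continuous_cvg _ (@exprn_continuous R k _)).
by rewrite -hm; exact: cvg_card_bseq_ratio.
Qed.
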